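(* Let $n \ge 2$, let $-1 = \hat x_0 < \hat x_1 < \dots < \hat x_{n-1} < \hat x_n = 1$ be floating point nodes, and let $m := \lfloor (n+1)/2 \rfloor$. Assume that sums can be computed as described in the context, with $\sigma_n$ and $\sigma_m$ such that $(8 + 1.01\,\sigma_n + 1.01\,\sigma_m)\,\epsilon < 0.01$. If $2 + \hat x_1$ and $2 - \hat x_{n-1}$ are floating point numbers, then, for $t \in [-1,1]$ (not a node) and function values $f = (f_0,\dots,f_n)$, the second barycentric formula $$b_n(t;f) = \frac{\sum_{i=0}^n \frac{\gamma_i f_i}{t - \hat x_i}}{\sum_{i=0}^n \frac{\gamma_i}{t - \hat x_i}}$$ with the simplified weights $\gamma_0 = 1/2$, $\gamma_n = (-1)^n/2$, $\gamma_i = (-1)^i$ for $1 \le i \le n-1$, can be evaluated in floating point arithmetic so that the computed value $\hat b_n(t;f)$ is equal to $b_n(t;\tilde f)$ for a vector $\tilde f = (\tilde f_0,\dots,\tilde f_n)$ with $$|\tilde f_i - f_i| \le (8.1 + 1.1\,\sigma_n + 1.1\,\sigma_m)\,|f_i|\,\epsilon \qquad \text{for } i = 0,\dots,n.$$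
   Context: Floating point model. Arithmetic is binary, without overflow or underflow, with machine precision $\epsilon > 0$, $\epsilon \approx 10^{-16}$. For real $\rho \ge 1$ let $\mathcal{E}_\rho = \{ z \in \mathbb{R} : (1-\epsilon)^{\rho} \le z \le (1-\epsilon)^{-\rho} \}$. For floating point numbers $x,y$ and $\mathrm{op} \in \{+,-,*,/\}$, the computed value is $\mathrm{fl}(x \,\mathrm{op}\, y) = (x \,\mathrm{op}\, y) z$ for some $z \in \mathcal{E}_1$; if $x \,\mathrm{op}\, y$ is itself a floating point number then $\mathrm{fl}(x \,\mathrm{op}\, y) = x \,\mathrm{op}\, y$; multiplication of a floating point number by a power of two is exact. Summation assumption. For each $n$, a sum of $n+1$ floating point numbers $a_0,\dots,a_n$ can be computed with result $\hat\sum_{i=0}^n a_i = \sum_{i=0}^n (1 + \delta_i \sigma_n \epsilon)\, a_i$, where $|\delta_i| \le 1$ (the $\delta_i$ may depend on the $a_i$) and $\sigma_n$ may depend on $n$ but not on the $a_i$; moreover $1 \le \sigma_n \le \sigma_{n+1}$. The point $t$, the nodes $\hat x_i$ and the values $f_i$ are floating point numbers. ''Can be evaluated'' means that there is a finite sequence of floating point operations (operations $\mathrm{op} \in \{+,-,*,/\}$ with computed value $\mathrm{fl}(x \,\mathrm{op}\, y)$) and summations (of $N+1$ floating point numbers $a_0,\dots,a_N$, with computed result $\hat\sum_{i=0}^N a_i = \sum_{i=0}^N (1 + \delta_i \sigma_N \epsilon)\, a_i$, $|\delta_i| \le 1$) (the choice may depend on $n$ and on the subinterval $(\hat x_k,\hat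 x_{k+1})$ containing $t$) which in exact arithmetic would return $b_n(t;f)$, and whose computed value has the stated property. The vector $\tilde f$ may depend on $t$. *)

(* Defs.v *)
From HB Require Import structures.
From mathcomp Require Import all_boot all_order all_algebra.
From mathcomp Require Import all_classical all_reals all_analysis.

Set Implicit Arguments.
Unset Strict Implicit.
Unset Printing Implicit Defensive.

Import Order.TTheory GRing.Theory Num.Theory.
Local Open Scope classical_set_scope.
Local Open Scope ring_scope.

Definition calE (R : realType) (eps rho : R) : set R :=
  [set z | (1 - eps) `^ rho <= z <= (1 - eps) `^ (- rho)].

Inductive fop := FAdd | FSub | FMul | FDiv.

Definition exact_op (R : realType) (o : fop) (x y : R) : R :=
  match o with
  | FAdd => x + y
  | FSub => x - y
  | FMul => x * y
  | FDiv => x / y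
  end.

(* Division by zero is 0 in MathComp, so it has to be ruled out explicitly. *)
Definition op_defined (R : realType) (o : fop) (y : R) : Prop :=
  if o is FDiv then y != 0 else True.

(* fsum M a is the computed sum of the N + 1 numbers a_0, ..., a_N.  The
   functions fl and fsum are constrained on floating point arguments only. *)
Record fpmodel (R : realType) := FPModel {
  eps : R;
  float : set R;
  fl : fop -> R -> R -> R;
  sigma : nat -> R;
  fsum : forall N : nat, ('I_N.+1 -> R) -> R;
  eps_gt0 : 0 < eps;
  float_pow2 : forall j : int, float (2 ^ j);
  fl_float : forall (o : fop) (x y : R), float x -> float y ->
    op_defined o y -> float (fl o x y);
  fl_round : forall (o : fop) (x y : R), float x -> float y ->
    op_defined o y ->
    exists2 z, calE eps 1 z & fl o x y = exact_op o x y * z;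
  fl_exact : forall (o : fop) (x y : R), float x -> float y ->
    op_defined o y -> float (exact_op o x y) -> fl o x y = exact_op o x y;
  fl_pow2 : forall (x : R) (j : int), float x -> fl FMul x (2 ^ j) = x * 2 ^ j;
  sigma_ge1 : forall N : nat, 1 <= sigma N;
  sigma_le : forall N : nat, sigma N <= sigma N.+1;
  fsum_float : forall (N : nat) (a : 'I_N.+1 -> R),
    (forall i, float (a i)) -> float (fsum a);
  fsum_round : forall (N : nat) (a : 'I_N.+1 -> R),
    (forall i, float (a i)) ->
    exists2 delta : 'I_N.+1 -> R, (forall i, `|delta i| <= 1) &
      fsum a = \sum_(i < N.+1) (1 + delta i * sigma N * eps) * a i
}.

(* A finite sequence of operations and summations on the data t, x_0, ..., x_n,
   f_0, ..., f_n and on constants 2 ^ j, as an expression: since fl and fsum are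
   functions, reusing an intermediate result amounts to repeating the
   subexpression that computes it. *)
Inductive prog (n : nat) : Type :=
  | PT
  | PX of 'I_n.+1
  | PF of 'I_n.+1
  | PPow2 of int
  | POp of fop & prog n & prog n
  | PSum (N : nat) of ('I_N.+1 -> prog n).

Record arith (R : realType) := Arith {
  ar_op : fop -> R -> R -> R;
  ar_sum : forall N : nat, ('I_N.+1 -> R) -> R
}.

Definition exact_arith (R : realType) : arith R :=
  @Arith R (@exact_op R) (fun N a => \sum_(i < N.+1) a i).

Definition fl_arith (R : realType) (M : fpmodel R) : arith R :=
  @Arith R (fl M) (@fsum R M).

Fixpoint eval (R : realType) (n : nat) (A : arith R) (t : R)
    (x f : 'I_n.+1 -> R) (p : prog n) : R :=
  match p with
  | PT => t
  | PX i => x i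
  | PF i => f i
  | PPow2 j => 2 ^ j
  | POp o p1 p2 => ar_op A o (eval A t x f p1) (eval A t x f p2)
  | PSum N q => ar_sum A (fun i : 'I_N.+1 => eval A t x f (q i))
  end.

Fixpoint eval_defined (R : realType) (n : nat) (A : arith R) (t : R)
    (x f : 'I_n.+1 -> R) (p : prog n) : Prop :=
  match p with
  | PT | PX _ | PF _ | PPow2 _ => True
  | POp o p1 p2 => [/\ eval_defined A t x f p1, eval_defined A t x f p2
                     & op_defined o (eval A t x f p2)]
  | PSum N q => forall i : 'I_N.+1, eval_defined A t x f (q i)
  end.

Definition returns (R : realType) (n : nat) (A : arith R) (t : R)
    (x f : 'I_n.+1 -> R) (p : prog n) (v : R) : Prop :=
  eval_defined A t x f p /\ eval A t x f p = v.

Definition gamma (R : realType) (n : nat) (i : 'I_n.+1) : R :=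
  if i == 0%N :> nat then 1 / 2
  else if i == n :> nat then (-1) ^+ n / 2
  else (-1) ^+ i.

Definition bary (R : realType) (n : nat) (x : 'I_n.+1 -> R) (t : R)
    (f : 'I_n.+1 -> R) : R :=
  (\sum_(i < n.+1) gamma R i * f i / (t - x i)) /
  (\sum_(i < n.+1) gamma R i / (t - x i)).

(* Main.v *)
Require Import Defs.
From HB Require Import structures.
From mathcomp Require Import all_boot all_order all_algebra.
From mathcomp Require Import all_classical all_reals all_analysis.
From mathcomp Require Import zify ring lra.

Set Implicit Arguments.
Unset Strict Implicit.
Unset Printing Implicit Defensive.

Import Order.TTheory GRing.Theory Num.Theory.
Local Open Scope ring_scope.

(** Let [x_k < t < x_(k+1)] and multiply the numerator and the denominator of
    the formula by [(-1)^k].  The terms [(-1)^k gamma_i / (t - x_i)] of the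
    denominator are then positive at [i = k] and [i = k + 1], and on either side
    of [t] they alternate in sign and decrease in modulus as [i] moves away from
    [t].  Adding them in adjacent pairs, starting next to [t] on each side,
    therefore turns the denominator into a sum of positive numbers
    ([block_gt0]; an end term left without partner is positive as well), at
    most [m + 1] of them, where [m] is the half of [n + 1] rounded down
    ([block_count_le]).

    Each pair can be computed with a small relative error even though it is a
    difference of two close numbers, because it has the closed form
    [(x_b - x_(b-1)) / ((t - x_(b-1)) * (t - x_b))], whose factors are
    differences of data.  When the pair contains an end node, the weight 1/2 of
    that node changes the first factor into [2 + x_1 + t] or
    [2 - x_(n-1) - t] over twice the product ([block_pair]); as [2 + x_1] and
    [2 - x_(n-1)] are floating point numbers, this factor still costs a single
    rounding, and doubling is exact.  So a pair costs five roundings: three for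
    the differences, one for the product, one for the quotient
    ([accurate_block]).

    A sum of positive numbers inherits the relative errors of its terms, so the
    computed denominator is the exact one times a scalar [Y], which gathers five
    roundings and one summation of at most [m + 1] numbers
    ([sum_factor_bounds]).  The term of index [i] of the numerator costs two
    roundings and one summation of [n + 1] numbers, and the final division one
    more rounding.  Since the denominator of the formula does not involve [f],
    all these factors, the inverse of [Y] included, can be charged to [f_i]
    ([bary_prog_backward]).  The eight roundings and the two summations amount
    to a relative perturbation of [f_i] by [(8 + sigma_n + sigma_m) eps] to first
    order, and the smallness assumption lets the margin in the constants absorb
    the terms of higher order ([perturbation_bound]). *)

(** * Products of rounding factors *)

Section Roundings.
Variables (R : realType) (e : R).
Hypotheses (e_gt0 : 0 < e) (e_lt1 : e < 1).

(** The exponent is a natural number, unlike in [calE], because it counts the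
    roundings behind [w]. *)
Definition rounded (r : nat) (v w : R) : Prop :=
  exists2 z, (1 - e) ^+ r <= z <= ((1 - e) ^+ r)^-1 & w = v * z.

Let q_gt0 : 0 < 1 - e. Proof. by rewrite subr_gt0. Qed.
Let qX_gt0 r : 0 < (1 - e) ^+ r. Proof. exact: exprn_gt0. Qed.

Lemma calE1 z : calE e 1 z -> (1 - e) ^+ 1 <= z <= ((1 - e) ^+ 1)^-1.
Proof. by rewrite /calE /= powRN powRr1 ?expr1 // ltW. Qed.

Lemma factor_gt0 r z : (1 - e) ^+ r <= z -> 0 < z.
Proof. exact: lt_le_trans. Qed.

Lemma factorM r s z y :
  (1 - e) ^+ r <= z <= ((1 - e) ^+ r)^-1 ->
  (1 - e) ^+ s <= y <= ((1 - e) ^+ s)^-1 ->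
  (1 - e) ^+ (r + s) <= z * y <= ((1 - e) ^+ (r + s))^-1.
Proof.
move=> /andP[z1 z2] /andP[y1 y2]; rewrite exprD invfM.
by rewrite !ler_pM // ?ltW // ?(factor_gt0 z1) ?(factor_gt0 y1).
Qed.

Lemma factorV r z :
  (1 - e) ^+ r <= z <= ((1 - e) ^+ r)^-1 ->
  (1 - e) ^+ r <= z^-1 <= ((1 - e) ^+ r)^-1.
Proof.
move=> /andP[z1 z2]; have z0 := factor_gt0 z1.
by rewrite lef_pV2 ?posrE // z1 andbT -[leLHS]invrK lef_pV2 ?posrE ?invr_gt0.
Qed.

Lemma rounded_refl v : rounded 0 v v.
Proof. by exists 1; rewrite ?mulr1 // expr0 invr1 lexx. Qed.

Lemma rounded_neq0 r v w : rounded r v w -> v != 0 -> w != 0.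
Proof.
move=> [z /andP[/factor_gt0 z_gt0 _] ->] v0.
by rewrite mulf_neq0 // gt_eqF.
Qed.

Lemma roundedM r s v v' w w' :
  rounded r v w -> rounded s v' w' -> rounded (r + s) (v * v') (w * w').
Proof.
move=> [z hz ->] [y hy ->]; exists (z * y); first exact: factorM.
by rewrite mulrACA.
Qed.

Lemma roundedV r v w : rounded r v w -> rounded r v^-1 w^-1.
Proof. by move=> [z hz ->]; exists z^-1; [exact: factorV | rewrite invfM]. Qed.

Lemma rounded_trans r s v w u :
  rounded r v w -> rounded s w u -> rounded (r + s) v u.
Proof.
move=> [z hz ->] [y hy ->]; exists (z * y); first exact: factorM.
by rewrite mulrA.
Qed.

Lemma rounded_weaken r s v w : (r <= s)%N -> rounded r v w -> rounded s v w.
Proof.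
move=> rs [z /andP[z1 z2] ->]; exists z => //.
have qs : (1 - e) ^+ s <= (1 - e) ^+ r.
  by rewrite ler_wiXn2l // ?(ltW q_gt0) // lerBlDr lerDl ltW.
by rewrite (le_trans qs z1) (le_trans z2) // lef_pV2 ?posrE.
Qed.

Lemma bernoulli_ge m : 1 - m%:R * e <= (1 - e) ^+ m.
Proof.
elim: m => [|m ih]; first by rewrite mul0r subr0 expr0.
rewrite exprS; apply: (@le_trans _ _ ((1 - e) * (1 - m%:R * e))).
  rewrite -natr1; have := ler0n R m.
  by move: (m%:R) => c c0; have := mulr_ge0 c0 (sqr_ge0 e); nra.
by rewrite ler_pM2l.
Qed.

End Roundings.

(** Here [A] stands for the factor of the summation in the numerator, [z] for its
    two roundings and that of the final division, and [Y] for the relative error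
    of the denominator.  To first order the quotient deviates from 1 by
    [8 * e + a + b]; the excess [e / 10 + (a + b) / 10] of the bound dominates
    the higher order terms, which are at most 1/100 of the bound. *)
Lemma perturbation_bound (R : realType) (e a b A z Y : R) :
  0 < e -> 0 <= a -> 0 <= b ->
  8 * e + 101 / 100 * a + 101 / 100 * b < 1 / 100 ->
  1 - a <= A <= 1 + a -> (1 - e) ^+ 3 <= z <= ((1 - e) ^+ 3)^-1 ->
  (1 - b) * (1 - e) ^+ 5 <= Y <= (1 + b) * ((1 - e) ^+ 5)^-1 ->
  `|A * z / Y - 1| <= 81 / 10 * e + 11 / 10 * a + 11 / 10 * b.
Proof.
move=> e0 a0 b0 small /andP[A1 A2] /andP[z1 z2] /andP[Y1 Y2].
set T := 81 / 10 * e + _ + _.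
have e1 : e < 1 by lra.
have q0 r : 0 < (1 - e) ^+ r by rewrite exprn_gt0 // subr_gt0.
have z0 : 0 < z by exact: lt_le_trans z1.
have Y0 : 0 < Y by apply: lt_le_trans Y1; rewrite mulr_gt0 //; lra.
have q8 : 1 - 8 * e <= (1 - e) ^+ 8 := bernoulli_ge e1 8.
have q8E : (1 - e) ^+ 8 = (1 - e) ^+ 3 * (1 - e) ^+ 5 by rewrite -exprD.
have T0 : 0 <= T by rewrite /T; lra.
have T1 : T <= 1 / 10 by rewrite /T; lra.
rewrite ler_norml lerBrDr lerBlDr ler_pdivrMr // ler_pdivlMr //.
apply/andP; split.
  apply: (@le_trans _ _ ((1 - a) * (1 - e) ^+ 3)); last first.
    by apply: ler_pM => //; [lra | exact: ltW].
  apply: (@le_trans _ _ ((1 - T) * ((1 + b) * ((1 - e) ^+ 5)^-1))).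
    by rewrite addrC ler_wpM2l //; lra.
  rewrite mulrA ler_pdivrMr // -mulrA -q8E.
  apply: (@le_trans _ _ ((1 - a) * (1 - 8 * e))); last first.
    by rewrite ler_wpM2l //; lra.
  by rewrite /T; nra.
apply: (@le_trans _ _ ((1 + a) * ((1 - e) ^+ 3)^-1)).
  by apply: ler_pM => //; [lra | exact: ltW].
apply: (@le_trans _ _ ((1 + T) * ((1 - b) * (1 - e) ^+ 5))); last first.
  by rewrite addrC ler_wpM2l //; lra.
rewrite ler_pdivrMr // -(mulrA (1 + T)) -(mulrA (1 - b)) (mulrC (_ ^+ 5)) -q8E.
apply: (@le_trans _ _ ((1 + T) * ((1 - b) * (1 - 8 * e)))); last first.
  by rewrite ler_wpM2l ?ler_wpM2l //; lra.
have h1 : 1 - (8 * e + b) <= (1 - b) * (1 - 8 * e) by nra.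
apply: (@le_trans _ _ ((1 + T) * (1 - (8 * e + b)))); last first.
  by rewrite ler_wpM2l //; lra.
by rewrite /T; nra.
Qed.

(** Nonnegative terms never cancel, so the relative errors of the terms bound that
    of the sum. *)
Lemma sum_factor_bounds (R : realType) (I : finType) (v c : I -> R) (lo hi : R) :
  (forall i, 0 <= v i) -> (forall i, lo <= c i <= hi) ->
  lo * (\sum_i v i) <= \sum_i c i * v i <= hi * (\sum_i v i).
Proof.
move=> v0 hc; rewrite !mulr_sumr.
by apply/andP; split; apply: ler_sum => i _; case/andP: (hc i) => h1 h2;
  rewrite ler_wpM2r.
Qed.

(** * Relative accuracy of programs *)

Section Accuracy.
Variables (R : realType) (M : fpmodel R) (n : nat).
Variables (t : R) (x f : 'I_n.+1 -> R).
Hypothesis eps_lt1 : eps M < 1.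

(** Couples the exact and the floating point runs of one program, so that a single
    pass over its operations proves that it is correct, that it never divides by
    zero and that its relative error is small. *)
Definition accurate (r : nat) (p : prog n) (v : R) : Prop :=
  [/\ returns (exact_arith R) t x f p v,
      eval_defined (fl_arith M) t x f p,
      float M (Defs.eval (fl_arith M) t x f p)
    & rounded (eps M) r v (Defs.eval (fl_arith M) t x f p)].

Lemma accurate_t : float M t -> accurate 0 (PT n) t.
Proof. by move=> ft; split=> //; exact: rounded_refl. Qed.

Lemma accurate_x i : float M (x i) -> accurate 0 (PX i) (x i).
Proof. by move=> ft; split=> //; exact: rounded_refl. Qed.

Lemma accurate_f i : float M (f i) -> accurate 0 (PF i) (f i).
Proof. by move=> ft; split=> //; exact: rounded_refl. Qed.

Lemma accurate_pow2 (j : int) : accurate 0 (PPow2 n j) (2 ^ j).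
Proof. by split=> //; [exact: float_pow2 | exact: rounded_refl]. Qed.

Lemma accurate_weaken r s p v :
  (r <= s)%N -> accurate r p v -> accurate s p v.
Proof.
move=> rs [? ? ? rp]; split=> //.
by apply: rounded_weaken rp => //; exact: eps_gt0.
Qed.

Lemma accurate0_eval p v : accurate 0 p v -> Defs.eval (fl_arith M) t x f p = v.
Proof.
by move=> [_ _ _ [z]]; rewrite expr0 invr1 -eq_le => /eqP <- ->; rewrite mulr1.
Qed.

(** Sums and differences may cancel, hence keep a small relative error only when
    their operands are computed exactly. *)
Lemma accurate_op o r p q v w : accurate 0 p v -> accurate 0 q w ->
  op_defined o w -> r = 1%N \/ r = 0%N /\ float M (exact_op o v w) ->
  accurate r (POp o p q) (exact_op o v w).
Proof.
move=> ap aq wd hr; have pE := accurate0_eval ap; have qE := accurate0_eval aq.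
case: ap aq => -[pd pv] pd' fp _ [[qd qv] qd' fq _].
split; rewrite /returns /=.
- by rewrite pv qv.
- by rewrite qE.
- by apply: fl_float => //; rewrite qE.
rewrite pE in fp *; rewrite qE in fq *.
case: hr => [-> | [-> fe]].
  have [z /calE1 hz ->] := fl_round fp fq wd.
  by exists z => //; apply: hz; exact: eps_lt1.
by rewrite (fl_exact fp fq wd fe); exact: rounded_refl.
Qed.

Lemma accurateM r s p q v w : accurate r p v -> accurate s q w ->
  accurate (r + s).+1 (POp FMul p q) (v * w).
Proof.
move=> [[pd pv] pd' fp rp] [[qd qv] qd' fq rq].
split; rewrite /returns /=; [by rewrite pv qv | by [] | exact: fl_float |].
have [z /calE1 hz ->] := fl_round (o := FMul) fp fq I.
rewrite -addn1; apply: rounded_trans (roundedM _ rp rq) _ => //.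
by exists z => //; exact: hz.
Qed.

Lemma accurateD r s p q v w : w != 0 -> accurate r p v -> accurate s q w ->
  accurate (r + s).+1 (POp FDiv p q) (v / w).
Proof.
move=> w0 [[pd pv] pd' fp rp] [[qd qv] qd' fq rq].
have q0 := rounded_neq0 eps_lt1 rq w0.
split; rewrite /returns /=; [by rewrite pv qv | by [] | exact: fl_float |].
have [z /calE1 hz ->] := fl_round (o := FDiv) fp fq q0.
rewrite -addn1; apply: rounded_trans (roundedM _ rp (roundedV _ rq)) _ => //.
by exists z => //; exact: hz.
Qed.

Lemma accurate_scale r p v (j : int) : accurate r p v ->
  accurate r (POp FMul p (PPow2 n j)) (v * 2 ^ j).
Proof.
move=> [[pd pv] pd' fp rp]; split; rewrite /returns /=.
- by rewrite pv.
- by [].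
- by apply: fl_float => //; exact: float_pow2.
by rewrite fl_pow2 // -[r]addn0; apply: roundedM rp _ => //; exact: rounded_refl.
Qed.

Lemma accurate_exact r p v : accurate r p v -> returns (exact_arith R) t x f p v.
Proof. by case. Qed.

Lemma fsum_accurate (r N : nat) (p : 'I_N.+1 -> prog n) (v : 'I_N.+1 -> R) :
  (forall i, accurate r (p i) (v i)) ->
  exists2 d : 'I_N.+1 -> R, forall i, `|d i| <= 1 &
  exists2 z : 'I_N.+1 -> R,
    forall i, (1 - eps M) ^+ r <= z i <= ((1 - eps M) ^+ r)^-1 &
    Defs.eval (fl_arith M) t x f (PSum p) =
      \sum_i (1 + d i * sigma M N * eps M) * z i * v i.
Proof.
move=> acc.
have [i|d d1 sE] :=
  @fsum_round _ M N (fun i => Defs.eval (fl_arith M) t x f (p i)).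
  by case: (acc i).
exists d => //.
have /boolp.choice [z zP] : forall i, exists z,
    (1 - eps M) ^+ r <= z <= ((1 - eps M) ^+ r)^-1 /\
    Defs.eval (fl_arith M) t x f (p i) = v i * z.
  by move=> i; case: (acc i) => _ _ _ [z hz hE]; exists z.
exists z; first by move=> i; case: (zP i).
rewrite /= sE; apply: eq_bigr => i _; case: (zP i) => _ ->.
by rewrite [v i * _]mulrC mulrA.
Qed.

End Accuracy.

Lemma sigma_homo (R : realType) (M : fpmodel R) (m N : nat) :
  (m <= N)%N -> sigma M m <= sigma M N.
Proof.
apply: (homo_leq (r := fun a b : R => a <= b)) => //.
- by move=> b a c; exact: le_trans.
- exact: sigma_le.
Qed.

Lemma summation_factor (R : realType) (M : fpmodel R) (N m : nat) (d b : R) :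
  (N <= m)%N -> `|d| <= 1 -> b = sigma M m * eps M ->
  1 - b <= 1 + d * sigma M N * eps M <= 1 + b.
Proof.
move=> Nm d1 ->; have sN := sigma_homo M Nm; have s1 := sigma_ge1 M N.
have h : `|d * sigma M N * eps M| <= sigma M m * eps M.
  rewrite !normrM (ger0_norm (ltW (eps_gt0 M))) ler_pM2r ?eps_gt0 //.
  rewrite (ger0_norm (_ : 0 <= sigma M N)); last exact: le_trans s1.
  by apply: le_trans sN; rewrite ler_piMl // (le_trans _ s1).
by move: h; rewrite ler_norml !lerD2l.
Qed.

(** * Pairing the terms of the denominator *)

Section Terms.
Variables (R : realType) (n k : nat) (x : 'I_n.+1 -> R) (t : R).

(** Indexed by natural numbers, because the arithmetic of the pairing leaves the
    ordinals. *)
Definition node (q : nat) : R := x (inord q).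

Definition end_weight (q : nat) : R :=
  if (q == 0%N) || (q == n) then 2^-1 else 1.

(** The sign [(-1) ^+ k], common to numerator and denominator, makes the terms next
    to [t] positive when [k] is the index of the node on the left of [t]. The
    value 0 beyond [n] lets the last pair be incomplete. *)
Definition term (q : nat) : R :=
  if (q <= n)%N then (-1) ^+ (k + q) * end_weight q / (t - node q) else 0.

(** A missing partner counts as 0: for [b = 0] and [b = n + 1] the block is a
    single end term. *)
Definition block (b : nat) : R := (if (0 < b)%N then term b.-1 else 0) + term b.

Lemma gamma_end_weight (i : 'I_n.+1) :
  Defs.gamma R i = (-1) ^+ i * end_weight i.
Proof.
rewrite /Defs.gamma /end_weight; case: eqP => [-> | _] /=.
  by rewrite expr0.
by case: eqP => [-> | _] /=; rewrite ?mulr1.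
Qed.

Lemma bary_term (f : 'I_n.+1 -> R) :
  bary x t f = (\sum_(i < n.+1) term i * f i) / (\sum_(i < n.+1) term i).
Proof.
have termE (i : 'I_n.+1) : term i = (-1) ^+ k * (Defs.gamma R i / (t - x i)).
  by rewrite /term -ltnS ltn_ord /node inord_val exprD gamma_end_weight !mulrA.
rewrite /bary (eq_bigr _ (fun i _ => termE i)).
rewrite [in RHS](eq_bigr (fun i : 'I_n.+1 =>
   (-1) ^+ k * (Defs.gamma R i * f i / (t - x i)))); last first.
  by move=> i _; rewrite termE; ring.
by rewrite -!mulr_sumr -mulf_div divff ?mul1r // signr_eq0.
Qed.

Lemma sum_adjacent (c : nat -> R) (o : bool) (m : nat) :
  \sum_(j < m.+1) ((if (0 < o + j.*2)%N then c (o + j.*2).-1 else 0)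
                   + c (o + j.*2)%N) = \sum_(i < (o + m.*2).+1) c i.
Proof.
elim: m => [|m ih].
  by case: o; rewrite !big_ord_recr !big_ord0 /= ?add0r.
rewrite big_ord_recr /= ih doubleS !addnS [RHS]big_ord_recr [in RHS]big_ord_recr.
by rewrite /= addrA.
Qed.

(** Blocks are indexed by the [b] of the parity of [k]: then [k] ends a block, so
    none straddles [t], and on each side the pairing starts next to [t]. *)
Lemma sum_block :
  \sum_(j < ((n + ~~ odd k)./2).+1) block (odd k + j.*2) =
  \sum_(i < n.+1) term i.
Proof.
rewrite [LHS]sum_adjacent.
have [-> //|->] : (odd k + (n + ~~ odd k)./2.*2 = n \/
   odd k + (n + ~~ odd k)./2.*2 = n.+1)%N.
  by have := odd_double_half (n + ~~ odd k); case: (odd k); case: (odd _); lia.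
by rewrite big_ord_recr /= {2}/term ltnn addr0.
Qed.

End Terms.

Lemma block_count_le (n : nat) (o : bool) : ((n + ~~ o)./2 <= n.+1 %/ 2)%N.
Proof. by rewrite divn2 half_leq //; case: o => /=; lia. Qed.

Lemma block_index_le (n : nat) (o : bool) (j : 'I_((n + ~~ o)./2).+1) :
  (o + j.*2 <= n.+1)%N.
Proof.
move: (nat_of_ord j) (ltn_ord j) => q {j}.
by have := odd_double_half (n + ~~ o); case: o; case: odd => /=; lia.
Qed.

(** * The program *)

Section Programs.
Variables (n k : nat).

Definition twice (p : prog n) : prog n := POp FMul p (PPow2 n 1).

(** The sign is moved into the order of the subtraction and the weight 1/2 is
    applied as a power of two, so that neither costs a rounding. *)
Definition numerator_prog (i : 'I_n.+1) : prog n :=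
  POp FDiv
    (if (i == 0%N :> nat) || (i == n :> nat)
     then POp FMul (PF i) (PPow2 n (-1)) else PF i)
    (if odd (k + i) then POp FSub (PX i) (PT n) else POp FSub (PT n) (PX i)).

Definition gap_prog (b : nat) : prog n :=
  if b == 1%N then POp FAdd (POp FAdd (PPow2 n 1) (PX (inord 1))) (PT n)
  else if b == n then POp FSub (POp FSub (PPow2 n 1) (PX (inord n.-1))) (PT n)
  else POp FSub (PX (inord b)) (PX (inord b.-1)).

Definition block_prog (b : nat) : prog n :=
  if b == 0%N then
    POp FDiv (PPow2 n 0) (twice (POp FSub (PT n) (PX (inord 0))))
  else if b == n.+1 then
    POp FDiv (PPow2 n 0) (twice (POp FSub (PX (inord n)) (PT n)))
  else
    let d := POp FMul (POp FSub (PT n) (PX (inord b.-1)))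
                      (POp FSub (PT n) (PX (inord b))) in
    POp FDiv (gap_prog b) (if (b == 1%N) || (b == n) then twice d else d).

Definition bary_prog : prog n :=
  POp FDiv (PSum numerator_prog)
    (PSum (fun j : 'I_((n + ~~ odd k)./2).+1 => block_prog (odd k + j.*2))).

End Programs.

(** * Closed form and positivity of the pairs *)

Section Interval.
Variables (R : realType) (n k : nat) (t : R) (x : 'I_n.+1 -> R).
Hypothesis n_ge2 : (2 <= n)%N.
Hypothesis k_ltn : (k < n)%N.
Hypothesis x_first : x ord0 = -1.
Hypothesis x_last : x ord_max = 1.
Hypothesis x_incr : forall i j : 'I_n.+1, (i < j)%N -> x i < x j.
Hypothesis t_in : x (inord k) < t < x (inord k.+1).

Local Notation X := (node x).
Local Notation D := (\sum_(i < n.+1) term k x t i).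

Lemma node_first : X 0 = -1.
Proof. by rewrite /node -x_first; congr x; apply: val_inj; rewrite /= inordK. Qed.

Lemma node_last : X n = 1.
Proof. by rewrite /node -x_last; congr x; apply: val_inj; rewrite /= inordK. Qed.

Lemma node_lt p q : (p < q <= n)%N -> X p < X q.
Proof. by move=> pq; apply: x_incr; rewrite !inordK //; lia. Qed.

Lemma node_le p q : (p <= q <= n)%N -> X p <= X q.
Proof.
move=> /andP[pq qn]; move: pq; rewrite leq_eqVlt => /orP[/eqP -> // | pq].
by apply/ltW/node_lt; rewrite pq.
Qed.

Lemma node_lt_t q : (q <= k)%N -> X q < t.
Proof.
move=> qk; case/andP: t_in => tk _; apply: le_lt_trans tk.
by apply: node_le; lia.
Qed.

Lemma t_lt_node q : (k < q <= n)%N -> t < X q.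
Proof.
move=> qk; case/andP: t_in => _ tk; apply: lt_le_trans tk _.
by apply: node_le; lia.
Qed.

Lemma t_neq_node q : (q <= n)%N -> t - X q != 0.
Proof.
move=> qn; rewrite subr_eq0; have [/node_lt_t h|kq] := leqP q k.
  by rewrite gt_eqF.
by rewrite lt_eqF // t_lt_node // kq.
Qed.

Lemma block_first : ~~ odd k -> block k x t 0 = 1 / ((t - X 0) * 2).
Proof.
move=> kE; rewrite /block ltnn add0r /term leq0n addn0 /end_weight /=.
by rewrite -signr_odd (negbTE kE) expr0 !mul1r invfM mulrC.
Qed.

Lemma block_last : odd n.+1 = odd k -> block k x t n.+1 = 1 / ((X n - t) * 2).
Proof.
move=> kE; rewrite /block /= /term leqnn ltnn addr0 -signr_odd oddD -kE.
rewrite addbC /= addbN addbb /= expr1 /end_weight eqxx orbT.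
by rewrite mulN1r mulNr -mulrN -invrN opprB mul1r invfM mulrC.
Qed.

Definition gap (b : nat) : R :=
  if b == 1%N then 2 + X 1 + t else if b == n then 2 - X n.-1 - t
  else X b - X b.-1.

(** An end weight 1/2 makes the pair
    [1 / (t - x_1) - 1 / (2 (t + 1)) = (2 (t + 1) - (t - x_1)) / (2 (t + 1) (t - x_1))],
    whence the special values of [gap]. *)
Lemma block_pair b : (0 < b <= n)%N -> odd b = odd k ->
  block k x t b =
  gap b / ((t - X b.-1) * (t - X b) * (if (b == 1%N) || (b == n) then 2 else 1)).
Proof.
move=> /andP[b0 bn] bk.
have := t_neq_node bn; have : t - X b.-1 != 0 by apply: t_neq_node; lia.
rewrite /block b0 /term bn (_ : (b.-1 <= n)%N); last lia.
have -> : (-1) ^+ (k + b) = 1 :> R by rewrite -signr_odd oddD bk addbb.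
have -> : (-1) ^+ (k + b.-1) = - 1 :> R.
  by rewrite -signr_odd oddD -bk -(prednK b0) /= addNb addbb.
rewrite /end_weight /gap.
have -> : (b == 0)%N = false by lia.
have -> : (b.-1 == n)%N = false by lia.
have -> : (b.-1 == 0)%N = (b == 1)%N by lia.
have [b1|_] := eqVneq b 1%N => /=.
  have -> : (b == n)%N = false by lia.
  by rewrite b1 /= node_first opprK => h1 h2; field; rewrite h1 h2.
have [bE|_] := eqVneq b n => /=.
  by rewrite bE node_last => h1 h2; field; rewrite h1 h2.
by move=> h1 h2; field; rewrite h1 h2.
Qed.

Lemma block_gt0 b : (b <= n.+1)%N -> odd b = odd k -> 0 < block k x t b.
Proof.
move=> bn bk; have [b0|b0] := posnP b.
  rewrite b0 in bk *; rewrite block_first -?bk //.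
  by rewrite divr_gt0 // mulr_gt0 // subr_gt0 node_lt_t.
have [bE|bE] := eqVneq b n.+1.
  rewrite bE in bk *; rewrite block_last //.
  by rewrite divr_gt0 // mulr_gt0 // subr_gt0 t_lt_node // k_ltn /=.
have {bE}bn : (b <= n)%N by lia.
rewrite block_pair ?b0 //.
have d_gt0 : 0 < (t - X b.-1) * (t - X b).
  have [bk'|bk'] := leqP b k.
    by rewrite mulr_gt0 // subr_gt0 node_lt_t //; lia.
  (* b and k have the same parity, so that b - 1 is on the right of t too *)
  have hb : b != k.+1 by lia.
  by rewrite nmulr_rgt0 subr_lt0 t_lt_node //; lia.
apply: divr_gt0; last by rewrite mulr_gt0 //; case: ifP.
rewrite /gap; case: eqP => [b1|_].
  have kt : X 1 < t by apply: node_lt_t; case: k bk => [|//]; rewrite b1.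
  have : X 0 < X 1 by apply: node_lt; lia.
  by rewrite node_first; lra.
case: eqP => [bn'|_]; last by rewrite subr_gt0; apply: node_lt; lia.
have hb : n.-1 != k by lia.
have : t < X n.-1 by apply: t_lt_node; lia.
have : X n.-1 < X n by apply: node_lt; lia.
by rewrite node_last; lra.
Qed.

Lemma block_index_odd (j : nat) : odd (odd k + j.*2) = odd k.
Proof. by rewrite oddD odd_double addbF oddb. Qed.

Lemma term_sum_gt0 : 0 < D.
Proof.
have pos (j : 'I_((n + ~~ odd k)./2).+1) : 0 < block k x t (odd k + j.*2).
  by apply: block_gt0; rewrite ?block_index_le ?block_index_odd.
rewrite -sum_block big_ord_recl ltr_wpDr ?(pos ord0) // sumr_ge0 // => j _.
exact/ltW/(pos (lift ord0 j)).
Qed.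

(** * Backward error of the program *)

Variables (M : fpmodel R) (f : 'I_n.+1 -> R).
Hypothesis eps_lt1 : eps M < 1.
Hypothesis float_x : forall i, float M (x i).
Hypothesis float_t : float M t.
Hypothesis float_f : forall i, float M (f i).
Hypothesis float_left : float M (2 + X 1).
Hypothesis float_right : float M (2 - X n.-1).

Local Notation acc := (accurate M t x f).

Let acc_X q : acc 0 (PX (inord q)) (X q).
Proof. exact: accurate_x. Qed.

Let acc_t : acc 0 (PT n) t. Proof. exact: accurate_t. Qed.

Let acc_2 : acc 0 (PPow2 n 1) 2. Proof. exact: (accurate_pow2 M t x f 1). Qed.

Let acc_1 : acc 0 (PPow2 n 0) 1. Proof. exact: (accurate_pow2 M t x f 0). Qed.

Lemma accurate_twice r p v : acc r p v -> acc r (twice p) (v * 2).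
Proof. exact: (accurate_scale eps_lt1 1). Qed.

Lemma accurate_dist q : acc 1 (POp FSub (PT n) (PX (inord q))) (t - X q).
Proof. by apply: (accurate_op eps_lt1 (o := FSub)) => //; left. Qed.

Lemma accurate_rdist q : acc 1 (POp FSub (PX (inord q)) (PT n)) (X q - t).
Proof. by apply: (accurate_op eps_lt1 (o := FSub)) => //; left. Qed.

Lemma accurate_gap b : acc 1 (gap_prog n b) (gap b).
Proof.
rewrite /gap_prog /gap; case: eqP => _.
  apply: (accurate_op eps_lt1 (o := FAdd)) => //; last by left.
  by apply: (accurate_op eps_lt1 (o := FAdd)) => //; right.
case: eqP => _; last by apply: (accurate_op eps_lt1 (o := FSub)) => //; left.
apply: (accurate_op eps_lt1 (o := FSub)) => //; last by left.
by apply: (accurate_op eps_lt1 (o := FSub)) => //; right.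
Qed.

Lemma accurate_block b : (b <= n.+1)%N -> odd b = odd k ->
  acc 5 (block_prog n b) (block k x t b).
Proof.
move=> bn bk; rewrite /block_prog; case: eqP => [b0|/eqP b0].
  rewrite b0 in bk *; rewrite block_first -?bk //.
  apply: (@accurate_weaken _ _ _ _ _ _ _ (0 + 1).+1) => //.
  apply: accurateD => //; first by rewrite mulf_neq0 ?t_neq_node.
  exact/accurate_twice/accurate_dist.
case: eqP => [bE|/eqP bE].
  rewrite bE in bk *; rewrite block_last //.
  apply: (@accurate_weaken _ _ _ _ _ _ _ (0 + 1).+1) => //.
  apply: accurateD => //; last exact/accurate_twice/accurate_rdist.
  by rewrite mulf_neq0 // -opprB oppr_eq0 t_neq_node.
have {bE}bn' : (b <= n)%N by lia.
have d0 : (t - X b.-1) * (t - X b) != 0.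
  by rewrite mulf_neq0 ?t_neq_node //; lia.
have d_acc := accurateM eps_lt1 (accurate_dist b.-1) (accurate_dist b).
rewrite block_pair ?bn' ?lt0n ?b0 //.
apply: (@accurateD _ _ _ _ _ _ eps_lt1 1 3); last 1 first.
- by case: ifP => _; [exact: accurate_twice | rewrite mulr1].
- by rewrite mulf_neq0 //; case: ifP.
- exact: accurate_gap.
Qed.

Lemma accurate_numerator (i : 'I_n.+1) :
  acc 2 (numerator_prog k i) (term k x t i * f i).
Proof.
have -> : term k x t i * f i =
  end_weight R n i * f i / ((-1) ^+ (k + i) * (t - X i)).
  by rewrite /term -ltnS ltn_ord invfM invr_sign; ring.
apply: (@accurateD _ _ _ _ _ _ eps_lt1 0 1).
- by rewrite mulf_neq0 ?signr_eq0 // t_neq_node // -ltnS.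
- rewrite /end_weight; case: ifP => _; last by rewrite mul1r; exact: accurate_f.
  by rewrite mulrC; apply: (accurate_scale eps_lt1 (-1)); exact: accurate_f.
rewrite -signr_odd -{2 3}[i]inord_val; case: odd.
  by rewrite expr1 mulN1r opprB; exact: accurate_rdist.
by rewrite expr0 mul1r; exact: accurate_dist.
Qed.

Let acc_block (j : 'I_((n + ~~ odd k)./2).+1) :
  acc 5 (block_prog n (odd k + j.*2)) (block k x t (odd k + j.*2)).
Proof. by apply: accurate_block; rewrite ?block_index_le ?block_index_odd. Qed.

Lemma bary_prog_exact : returns (exact_arith R) t x f (bary_prog n k) (bary x t f).
Proof.
have numE i := accurate_exact (accurate_numerator i).
have denE j := accurate_exact (acc_block j).
have DE : \sum_j Defs.eval (exact_arith R) t x f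
    (block_prog n (odd k + (j : 'I_((n + ~~ odd k)./2).+1).*2)) = D.
  by rewrite -sum_block; apply: eq_bigr => j _; case: (denE j).
split=> /=; rewrite DE.
  split; last by rewrite /= gt_eqF // term_sum_gt0.
  - by move=> i; case: (numE i).
  - by move=> j; case: (denE j).
rewrite (bary_term k); congr (_ / _).
by apply: eq_bigr => i _; case: (numE i).
Qed.

Lemma bary_prog_backward (a b : R) :
  a = sigma M n * eps M -> b = sigma M (n.+1 %/ 2) * eps M ->
  8 * eps M + 101 / 100 * a + 101 / 100 * b < 1 / 100 ->
  exists2 ft : 'I_n.+1 -> R,
    returns (fl_arith M) t x f (bary_prog n k) (bary x t ft) &
    forall i, `|ft i - f i| <=
      (81 / 10 * eps M + 11 / 10 * a + 11 / 10 * b) * `|f i|.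
Proof.
move=> aE bE small; have e0 := eps_gt0 M; have D0 := term_sum_gt0.
have a0 : 0 <= a by rewrite aE mulr_ge0 ?(ltW e0) // (le_trans _ (sigma_ge1 _ _)).
have b0 : 0 <= b by rewrite bE mulr_ge0 ?(ltW e0) // (le_trans _ (sigma_ge1 _ _)).
have [d d1 [z zP numE]] := fsum_accurate accurate_numerator.
have [d' d'1 [y yP denE]] := fsum_accurate acc_block.
set Nh := Defs.eval _ _ _ _ _ in numE.
set Dh := Defs.eval _ _ _ _ _ in denE.
set Y := Dh / D.
have YP : (1 - b) * (1 - eps M) ^+ 5 <= Y <= (1 + b) * ((1 - eps M) ^+ 5)^-1.
  rewrite ler_pdivlMr // ler_pdivrMr // -sum_block denE.
  apply: sum_factor_bounds => j.
    by apply/ltW/block_gt0; rewrite ?block_index_le ?block_index_odd.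
  have /andP[y1 y2] := yP j.
  have /andP[h1 h2] := summation_factor (block_count_le n (odd k)) (d'1 j) bE.
  have q5 : 0 <= (1 - eps M) ^+ 5 by rewrite exprn_ge0 // subr_ge0 ltW.
  have b1 : 0 <= 1 - b by lra.
  rewrite !ler_pM //; [exact: le_trans h1 | exact: le_trans y1].
have Y0 : 0 < Y.
  case/andP: YP => Y1 _; apply: lt_le_trans Y1.
  by rewrite mulr_gt0 ?exprn_gt0 //; lra.
have DhE : Dh = D * Y by rewrite /Y mulrC divfK ?gt_eqF.
have Dh0 : Dh != 0 by rewrite DhE mulf_neq0 ?gt_eqF.
have Nfl : float M Nh by apply: fsum_float => i; case: (accurate_numerator i).
have Dfl : float M Dh by apply: fsum_float => j; case: (acc_block j).
have [z' /(calE1 eps_lt1) z'P divE] := fl_round (o := FDiv) Nfl Dfl Dh0.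
(* Y does not depend on i, hence its inverse can be charged to every f_i *)
exists (fun i => f i * ((1 + d i * sigma M n * eps M) * (z i * z') / Y)).
  split.
    by split=> [i|j|]; [case: (accurate_numerator i) | case: (acc_block j) |].
  rewrite [LHS]divE /= (bary_term k) numE DhE.
  move: D Y D0 Y0 {YP DhE} => S Y' S0 Y'0; rewrite !mulr_suml.
  by apply: eq_bigr => i _; field; rewrite !gt_eqF.
move=> i; rewrite -[X in _ - X]mulr1 -mulrBr normrM mulrC ler_wpM2r //.
apply: perturbation_bound => //; last exact: factorM (zP i) z'P.
exact: summation_factor (leqnn n) (d1 i) aE.
Qed.

End Interval.

Lemma exists_interval (R : realType) (n : nat) (x : 'I_n.+1 -> R) (t : R) :
  x ord0 < t < x ord_max -> (forall i, t != x i) ->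
  exists k : 'I_n, x (inord k) < t < x (inord k.+1).
Proof.
move=> /andP[t0 tn] tx.
have P0 : exists q, (q <= n)%N && (x (inord q) < t).
  exists 0%N; rewrite leq0n /= (_ : inord 0 = ord0) //.
  by apply: val_inj; rewrite /= inordK.
have [|k /andP[kn xk] kmax] := ex_maxnP (m := n) P0; first by move=> q /andP[].
have {}kn : (k < n)%N.
  rewrite ltn_neqAle kn andbT; apply/eqP => kE; move: xk.
  rewrite kE (_ : inord n = ord_max); last by apply: val_inj; rewrite /= inordK.
  by rewrite ltNge (ltW tn).
exists (Ordinal kn); rewrite /= xk /= ltNge le_eqVlt eq_sym (negbTE (tx _)) /=.
by apply/negP => h; have := kmax k.+1; rewrite kn h ltnn => /(_ isT).
Qed.

Theorem theorem1 (R : realType) (n : nat) (hn : (2 <= n)%N) :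
  exists P : 'I_n -> prog n,
  forall (M : fpmodel R) (x : 'I_n.+1 -> R) (t : R) (f : 'I_n.+1 -> R),
    x ord0 = -1 -> x ord_max = 1 ->
    (forall i j : 'I_n.+1, (i < j)%N -> x i < x j) ->
    (forall i : 'I_n.+1, float M (x i)) ->
    (8 + 101 / 100 * sigma M n + 101 / 100 * sigma M (n.+1 %/ 2)) * eps M
      < 1 / 100 ->
    float M (2 + x (inord 1)) ->
    float M (2 - x (inord n.-1)) ->
    float M t -> -1 <= t <= 1 -> (forall i : 'I_n.+1, t != x i) ->
    (forall i : 'I_n.+1, float M (f i)) ->
    exists k : 'I_n,
      [/\ x (inord k) < t < x (inord k.+1),
          returns (exact_arith R) t x f (P k) (bary x t f)
        & exists2 ft : 'I_n.+1 -> R,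
            returns (fl_arith M) t x f (P k) (bary x t ft)
          & forall i : 'I_n.+1,
              `|ft i - f i| <=
                (81 / 10 + 11 / 10 * sigma M n
                   + 11 / 10 * sigma M (n.+1 %/ 2)) * `|f i| * eps M].
Proof.
exists (fun k : 'I_n => bary_prog n k).
move=> M x t f x0 xn x_incr xfl small lfl rfl tfl /andP[tge tle] tx ffl.
have [k tk] : exists k : 'I_n, x (inord k) < t < x (inord k.+1).
  apply: exists_interval => //.
  by rewrite !lt_neqAle x0 tge xn tle -x0 -xn tx eq_sym tx.
have kn := ltn_ord k.
have eps0 := eps_gt0 M.
have sn := sigma_ge1 M n; have sm := sigma_ge1 M (n.+1 %/ 2).
(* the coefficient of eps in the smallness assumption exceeds 1 *)
have eps1 : eps M < 1.
  have := ler_pM2r eps0 1 (8 + 101 / 100 * sigma M n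
    + 101 / 100 * sigma M (n.+1 %/ 2)); rewrite mul1r => h.
  have : eps M < 1 / 100 by apply: le_lt_trans small; rewrite h; lra.
  by move/lt_trans; apply; lra.
exists k; split=> //; first exact: (bary_prog_exact hn kn x0 xn x_incr tk
  eps1 xfl tfl ffl lfl rfl).
have [|ft ft_ret ft_le] := bary_prog_backward hn kn x0 xn x_incr tk
  eps1 xfl tfl ffl lfl rfl (erefl _) (erefl _).
  by rewrite 2!(mulrA (101 / 100)) -2!mulrDl.
exists ft => // i; apply: le_trans (ft_le i) _.
by rewrite [leRHS]mulrAC 2!(mulrA (11 / 10)) -2!mulrDl.
Qed.
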